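(* Let $(X,d)$ be a metric space, let $f:X\to X$ be a map such that $(X,d)$ is $f$-orbitally complete, let $x_0\in X$, and let $0<a<1$. Let $\varphi_{x_0}:(0,\infty)\to(0,\infty)$ be a function such that $\varphi_{x_0}(t)<t$ and $\limsup_{s\to t^+}\varphi_{x_0}(s)<t$ for all $t>0$. Suppose that for all $x,y\in\overline{O(x_0,f)}$ with $x\neq y$, $$d(f(x),f(y))\le \varphi_{x_0}\big(\max\{d(x,y),\ a\,d(x,f(x))+(1-a)\,d(y,f(y)),\ (1-a)\,d(x,f(x))+a\,d(y,f(y))\}\big).$$ Let $z=\lim_{n\to\infty}f^n(x_0)\in X$. Then $z$ is a fixed point of $f$, i.e. $f(z)=z$ (without assuming that $f$ is orbitally continuous at $z$).
   Context: For a map $f:X\to X$ and $x\in X$, the orbit is $O(x,f)=\{x,f(x),f^2(x),f^3(x),\ldots\}$, where $f^n$ is the $n$-th iterate of $f$, and $\overline{O(x,f)}$ denotes its closure in $X$. The metric space $(X,d)$ is called $f$-orbitally complete if every Cauchy sequence contained in $O(x,f)$, for some $x\in X$, converges in $X$. The map $f$ is orbitally continuous at a point $z$ if, for every $x\in X$ and every sequence of positive integers $(m_i)$, $f^{m_i}(x)\to z$ implies $f(f^{m_i}(x))\to f(z)$. It is a known earlier result (R. K. Bisht) that under the stated hypotheses the sequence $(f^n(x_0))$ is Cauchy and converges in $X$, so that $z$ is well defined. *)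

(* Defs.v *)
From mathcomp Require Import all_boot all_order all_algebra.
From mathcomp Require Import all_classical all_reals all_analysis.

Set Implicit Arguments.
Unset Strict Implicit.
Unset Printing Implicit Defensive.

Local Open Scope classical_set_scope.

Definition orbit_set (X : Type) (f : X -> X) (x : X) : set X :=
  range (fun n : nat => iter n f x).

(* [metricType] is not pointed, so convergence in X is stated by an explicit
   limit instead of the library's [cvg]. *)
Definition orbitally_complete (R : realType) (X : metricType R)
    (f : X -> X) : Prop :=
  forall (x : X) (u : nat -> X), range u `<=` orbit_set f x ->
    cauchy (u n @[n --> \oo]) -> exists l : X, u n @[n --> \oo] --> l.

(* Main.v *)
Require Import Defs.
From mathcomp Require Import all_boot all_order all_algebra.
From mathcomp Require Import all_classical all_reals all_analysis.
From mathcomp Require Import lra.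
Import Order.TTheory GRing.Theory Num.Theory.
Import numFieldNormedType.Exports.

Set Implicit Arguments.
Unset Strict Implicit.
Unset Printing Implicit Defensive.

Local Open Scope classical_set_scope.
Local Open Scope ring_scope.

(** Write [c n] for the distance from [f^n(x0)] to [f^(n+1)(x0)].  The bounds on
[phi] make [f] a Meir-Keeler map for the maximum [gauge] of the contractive
condition: for every [e > 0] there is [d > 0] such that [gauge x y < e + d]
forces [f x] and [f y] to be at distance less than [e] (lemma [meir_keeler]).
Everything else follows from this property alone.

The sequence [c] is nonincreasing, because the last two terms of the maximum
are convex combinations of consecutive values of [c]; its infimum is [0],
since a positive infimum [e] would be undercut one step after [c] has come
within [d] of it (lemma [orbit_step_small]).  Once [c n < d <= e], the ball of
radius [e + d] around [f^n(x0)] contains the rest of the orbit: if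
[f^(n+k)(x0)] lies in it, then [f] brings the two points to distance less
than [e], and [c n < d] pays for the shift of the first one
(lemma [orbit_cauchy]).  Hence the orbit converges to some [z].

Finally let [r] be the distance from [z] to [f z], and suppose [r > 0].  As
[n] grows, the gauge of [f^n(x0)] and [z] gets arbitrarily close to
[max(a, 1 - a) * r], which is less than [r] because [0 < a < 1], whereas it
bounds the distance from [f^(n+1)(x0)] to [f z], which tends to [r].  This is
where continuity of [f] at [z] is dispensed with
(lemma [orbit_limit_fixed]). *)

(** The maximum that controls the distance of [f x] and [f y]. *)
Definition gauge (R : realType) (X : metricType R) (f : X -> X) (a : R)
    (x y : X) : R :=
  Num.max (mdist x y)
    (Num.max (a * mdist x (f x) + (1 - a) * mdist y (f y))
             ((1 - a) * mdist x (f x) + a * mdist y (f y))).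

(** The Meir-Keeler condition on [A], with [gauge] in place of the distance. *)
Definition meir_keeler_on (R : realType) (X : metricType R) (f : X -> X)
    (a : R) (A : set X) : Prop :=
  forall e : R, 0 < e -> exists2 d : R, 0 < d &
    forall x y : X, A x -> A y -> x <> y ->
      gauge f a x y < e + d -> mdist (f x) (f y) < e.

(** * The Meir-Keeler condition *)

Lemma mdist_neq_gt0 (R : realType) (X : metricType R) (x y : X) :
  x <> y -> 0 < mdist x y.
Proof. by move=> /eqP xy; rewrite mdist_gt0. Qed.

Lemma gauge_gt0 (R : realType) (X : metricType R) (f : X -> X) (a : R)
    (x y : X) :
  x <> y -> 0 < gauge f a x y.
Proof. by move=> xy; rewrite /gauge lt_max mdist_neq_gt0. Qed.

Lemma gauge_lt (R : realType) (X : metricType R) (f : X -> X) (a : R)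
    (x y : X) (r : R) :
  (gauge f a x y < r) =
  [&& mdist x y < r,
      a * mdist x (f x) + (1 - a) * mdist y (f y) < r &
      (1 - a) * mdist x (f x) + a * mdist y (f y) < r].
Proof. by rewrite /gauge !gt_max. Qed.

(** The limsup controls [phi] just above [e], and [phi s < s] controls it on
    the rest of the interval. *)
Lemma phi_lt_near (R : realType) (phi : R -> R)
    (phi_lt : forall t : R, 0 < t -> phi t < t)
    (phi_limsup : forall t : R, 0 < t ->
       (limf_esup (fun s : R => (phi s)%:E) t^'+ < t%:E)%E) (e : R) :
  0 < e ->
  exists2 d : R, 0 < d & forall s : R, 0 < s -> s < e + d -> phi s < e.
Proof.
move=> e0; have := phi_limsup _ e0.
rewrite /limf_esup => /ereal_inf_lt[_ [V [d /= d0 dV] <-] supV].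
exists d => // s s0 sed; have [se|es|->] := ltgtP s e; last exact: phi_lt.
  exact: lt_trans (phi_lt _ s0) se.
rewrite -lte_fin; apply: le_lt_trans supV; apply: ereal_sup_ubound.
exists s => //; apply: dV => //=.
by rewrite distrC gtr0_norm ?subr_gt0// ltrBlDl.
Qed.

Lemma meir_keeler (R : realType) (X : metricType R) (f : X -> X) (a : R)
    (A : set X) (phi : R -> R)
    (phi_lt : forall t : R, 0 < t -> phi t < t)
    (phi_limsup : forall t : R, 0 < t ->
       (limf_esup (fun s : R => (phi s)%:E) t^'+ < t%:E)%E)
    (contr : forall x y : X, A x -> A y -> x <> y ->
       mdist (f x) (f y) <= phi (gauge f a x y)) :
  meir_keeler_on f a A.
Proof.
move=> e /(phi_lt_near phi_lt phi_limsup)[d d0 phid]; exists d => //.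
move=> x y Ax Ay xy g.
by apply: le_lt_trans (contr _ _ Ax Ay xy) (phid _ _ g); exact: gauge_gt0.
Qed.

Lemma meir_keeler_lt (R : realType) (X : metricType R) (f : X -> X) (a : R)
    (A : set X) (mk : meir_keeler_on f a A) (x y : X) :
  A x -> A y -> x <> y -> mdist (f x) (f y) < gauge f a x y.
Proof.
move=> Ax Ay xy; have [d d0] := mk _ (gauge_gt0 f a xy).
by apply => //; rewrite ltrDl.
Qed.

(** * The orbit is a Cauchy sequence *)

Lemma orbit_step_le (R : realType) (X : metricType R) (f : X -> X) (a : R)
    (A : set X) (mk : meir_keeler_on f a A) (a0 : 0 < a) (a1 : a < 1) (x : X) :
  A x -> A (f x) -> mdist (f x) (f (f x)) <= mdist x (f x).
Proof.
move=> Ax Afx; rewrite leNgt; apply/negP => lt_step.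
have xfx : x <> f x by move=> xE; rewrite -xE -xE ltxx in lt_step.
have := meir_keeler_lt mk Ax Afx xfx; apply/negP; rewrite -leNgt.
(* Convex combinations of the two steps do not exceed the larger one. *)
by rewrite /gauge !ge_max; apply/and3P; split; nra.
Qed.

Lemma orbit_step_small (R : realType) (X : metricType R) (f : X -> X) (a : R)
    (x0 : X) (A : set X) (mk : meir_keeler_on f a A) (a0 : 0 < a) (a1 : a < 1)
    (Ax : forall n, A (iter n f x0)) (e : R) :
  0 < e ->
  exists N, forall n, (N <= n)%N ->
    mdist (iter n f x0) (iter n.+1 f x0) < e.
Proof.
move=> e0; pose c n := mdist (iter n f x0) (iter n.+1 f x0).
have cS n : c n.+1 <= c n := orbit_step_le mk a0 a1 (Ax n) (Ax n.+1).
have c_homo : nonincreasing_seq c by exact/nonincreasing_seqP.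
suff [N cN] : exists N, c N < e.
  by exists N => n Nn; exact: le_lt_trans (c_homo _ _ Nn) cN.
have c_lb : has_lbound (range c) by exists 0 => _ [n _ <-]; exact: mdist_ge0.
have c_inf : has_inf (range c) by split=> //; exists (c 0%N), 0%N.
have inf_c n : inf (range c) <= c n by apply: ge_inf => //; exists n.
have [inf0|inf_gt0] := leP (inf (range c)) 0.
  have [_ [N _ <-] cN] := inf_adherent e0 c_inf.
  by exists N; rewrite (lt_le_trans cN)// gerDr.
(* A positive infimum is undercut by the step following one close to it. *)
have [d d0 mkd] := mk _ inf_gt0.
have [_ [N _ <-] cN] := inf_adherent d0 c_inf.
have := inf_c N.+1; rewrite leNgt => /negP; case.
apply: mkd (Ax N) (Ax N.+1) _ _.
  move=> xE; have := lt_le_trans inf_gt0 (inf_c N).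
  by rewrite /c -xE mdistxx ltxx.
have := cS N; rewrite gauge_lt -/(c N) -/(c N.+1) => cSN.
by apply/and3P; split=> //; nra.
Qed.

Lemma orbit_cauchy (R : realType) (X : metricType R) (f : X -> X) (a : R)
    (x0 : X) (A : set X) (mk : meir_keeler_on f a A) (a0 : 0 < a) (a1 : a < 1)
    (Ax : forall n, A (iter n f x0)) :
  cauchy (iter n f x0 @[n --> \oo]).
Proof.
apply/cauchy_exP => e e0.
have e20 : 0 < e / 2 by rewrite divr_gt0.
have [d' d'0 mkd'] := mk _ e20.
pose d := Num.min d' (e / 2).
have d0 : 0 < d by rewrite lt_min d'0.
have dd' : d <= d' by rewrite ge_min lexx.
have de : d <= e / 2 by rewrite ge_min lexx orbT.
have [N cN] := orbit_step_small mk a0 a1 Ax d0.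
suff near_N k : mdist (iter N f x0) (iter (k + N) f x0) < e / 2 + d.
  exists (iter N f x0); exists N => // n /= Nn.
  rewrite ballEmdist /= -(subnK Nn); apply: lt_le_trans (near_N _) _.
  lra.
elim: k => [|k IHk]; first by rewrite add0n mdistxx addr_gt0.
apply: le_lt_trans (metric_triangle _ (iter N.+1 f x0) _) _.
rewrite addrC ltrD// ?cN// addSn !iterS.
have [->|/eqP xy] := eqVneq (iter N f x0) (iter (k + N) f x0).
  by rewrite mdistxx.
apply: mkd' => //; rewrite gauge_lt (lt_le_trans IHk) ?lerD2l//=.
have := cN _ (leqnn N); have := cN _ (leq_addl k N); rewrite !iterS.
by move=> c1 c2; apply/andP; split; nra.
Qed.

(** * The limit of the orbit is a fixed point *)

Lemma closure_cvgn (X : topologicalType) (A : set X) (u : nat -> X) (z : X) :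
  (forall n, A (u n)) -> u n @[n --> \oo] --> z -> closure A z.
Proof.
move=> Au uz; apply: (closed_cvg (closure A)) uz; first exact: closed_closure.
by apply: nearW => n; exact: subset_closure.
Qed.

Lemma orbit_limit_fixed (R : realType) (X : metricType R) (f : X -> X) (a : R)
    (x0 z : X) (A : set X) (mk : meir_keeler_on f a A)
    (a0 : 0 < a) (a1 : a < 1) (Ax : forall n, A (iter n f x0)) (Az : A z) :
  iter n f x0 @[n --> \oo] --> z -> f z = z.
Proof.
move=> xz; have [//|/eqP/nesym zfz] := eqVneq (f z) z; exfalso.
have r0 := mdist_neq_gt0 zfz; set r := mdist z (f z) in r0.
(* The gauge tends to at most [(1 - b) * r] and the distance to [f z] tends to
   [r]; an error of size [h] on each side has to fit into the gap [b * r]. *)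
pose b := Num.min a (1 - a); pose h := b * r / 2.
have b0 : 0 < b by rewrite lt_min a0 subr_gt0.
have ba : b <= a by rewrite ge_min lexx.
have b1a : b <= 1 - a by rewrite ge_min lexx orbT.
have br0 : 0 < b * r by rewrite mulr_gt0.
have h0 : 0 < h by rewrite divr_gt0.
have [N1 cN1] := orbit_step_small mk a0 a1 Ax h0.
have /metricType_numDomainType.cvgrPdist_lt/(_ _ h0)[N2 _ cN2] := xz.
pose n := maxn N1 N2.
have cn := cN1 n (leq_maxl _ _).
have dn := cN2 n (leq_maxr _ _).
have dSn := cN2 n.+1 (leqW (leq_maxr _ _)).
rewrite /= in cn dn dSn.
(* The step at [z] is [r], too large for a late point of the orbit. *)
have xnz : iter n f x0 <> z.
  by move=> xE; move: cn; rewrite xE -/r => rh; rewrite /h in rh; nra.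
have := meir_keeler_lt mk (Ax n) Az xnz.
apply/negP; rewrite -leNgt.
have := metric_triangle z (f (iter n f x0)) (f z); rewrite -/r => tri.
rewrite metric_sym in dn; apply: ltW; rewrite gauge_lt -/r.
have := mdist_ge0 (iter n f x0) (f (iter n f x0)).
rewrite /h in h0 cn dn dSn.
by move=> c0; apply/and3P; split; nra.
Qed.

(* [phi] is a total function on R of which only the restriction to (0, +oo)
   matters: [d(x, y) > 0] is the first term of the maximum, and the filter
   [t^'+] with [0 < t] only sees values [s > t].  The conclusion spells out
   that z = lim f^n(x0) exists; it is unique since X is metric. *)
Theorem mainTheorem1 (R : realType) (X : metricType R) (f : X -> X)
    (hcomplete : orbitally_complete f) (x0 : X)
    (a : R) (ha0 : 0 < a) (ha1 : a < 1)
    (phi : R -> R)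
    (hphi_pos : forall t : R, 0 < t -> 0 < phi t)
    (hphi_lt : forall t : R, 0 < t -> phi t < t)
    (hphi_limsup : forall t : R, 0 < t ->
       (limf_esup (fun s : R => (phi s)%:E) t^'+ < t%:E)%E)
    (hcontr : forall x y : X,
       closure (orbit_set f x0) x -> closure (orbit_set f x0) y -> x <> y ->
       mdist (f x) (f y) <=
         phi (Num.max (mdist x y)
               (Num.max (a * mdist x (f x) + (1 - a) * mdist y (f y))
                        ((1 - a) * mdist x (f x) + a * mdist y (f y))))) :
  exists z : X, (iter n f x0 @[n --> \oo] --> z) /\ f z = z.
Proof.
pose A := closure (orbit_set f x0).
have orbA n : orbit_set f x0 (iter n f x0) by exists n.
have Ax n : A (iter n f x0) by exact: subset_closure.
have mk : meir_keeler_on f a A by exact: meir_keeler hphi_lt hphi_limsup hcontr.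
have [z xz] : exists z : X, iter n f x0 @[n --> \oo] --> z.
  apply: (hcomplete x0) => [_ [n _ <-] //|].
  exact: orbit_cauchy mk ha0 ha1 Ax.
exists z; split=> //.
exact: orbit_limit_fixed mk ha0 ha1 Ax (closure_cvgn orbA xz) xz.
Qed.
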